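(* In the log-linear model $$\eta_{jk}=\log\mu_{jk}=\alpha+\rho_j+\gamma_k+z_{jk}^T\vec\theta,\qquad 0\le j\le J,\ 0\le k\le K,$$ (under any of the four sampling schemes (M), (P), (MR), (MC)) the asymptotic covariance matrix of the estimator $\vec{\hat\theta}$ is $$\Sigma_{\hat\theta}=\bigl((Z^{\circ})^{T}(C^TD^{-1}C)^{-1}Z^{\circ}\bigr)^{-1}$$ with $D=\mathrm{diag}\{\vec\mu\}$. The matrix $C^TD^{-1}C$ has, for $j,l\in\{1,\dots,J\}$ with $j\ne l$ and $k,m\in\{1,\dots,K\}$ with $k\neq m$, the elements $$(C^TD^{-1}C)_{jk,jk}=\mu_{jk}^{-1}+\mu_{00}^{-1}+\mu_{j0}^{-1}+\mu_{0k}^{-1},\qquad (C^TD^{-1}C)_{jk,lm}=\mu_{00}^{-1},$$ $$(C^TD^{-1}C)_{jk,jm}=\mu_{00}^{-1}+\mu_{j0}^{-1},\qquad (C^TD^{-1}C)_{jk,lk}=\mu_{00}^{-1}+\mu_{0k}^{-1}.$$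
   Context: Tables. $J,K\ge 1$ are integers and $I=(J+1)(K+1)$. Tables $a=(a_{jk})$ with $0\le j\le J$, $0\le k\le K$ are identified with vectors $\vec a\in\mathbb R^I$ by stacking columns. $\vec e_{jk}\in\mathbb R^I$ is the unit vector of the table with a one at position $(j,k)$ and zeros elsewhere; a subscript $+$ denotes summation over the replaced index, e.g. $\vec e_{j+}=\sum_k\vec e_{jk}$, $\vec e_{+k}=\sum_j\vec e_{jk}$, $\vec e_{++}=\sum_{j,k}\vec e_{jk}$. Tables indexed by $j=1,\dots,J$, $k=1,\dots,K$ are vectorized in the same way into $\mathbb R^{JK}$. Spaces. $\mathscr D=\mathrm{span}\{\vec e_{++}\}$, $\mathscr R=\mathrm{span}\{\vec e_{0+},\dots,\vec e_{J+}\}$, $\mathscr C=\mathrm{span}\{\vec e_{+0},\dots,\vec e_{+K}\}$. Projections. For a symmetric positive definite $I\times I$ matrix $D$ and a linear subspace $\mathscr M\subset\mathbb R^I$, $P^D_{\mathscr M}$ is the ($I\times I$ matrix of the) orthogonal projection onto $\mathscr M$ with respect to the inner product $\langle a,b\rangle_D=a^TDb$. Model. $R=(R_{jk})$ is a random table of counts with expected table $\mu=(\mu_{jk})=\mathbb E(R)$, all $\mu_{jk}>0$, $\eta_{jk}=\log\mu_{jk}$, $D=\mathrm{diag}\{\vec\mu\}$. The model is $\eta_{jk}=\alpha+\rho_j+\gamma_k+z_{jk}^T\vec\theta$ with $\rho_0=\gamma_0=0$, known vectors $z_{jk}\in\mathbb R^L$ with $z_{j0}=z_{0k}=0$ for all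 $j,k$, and unknown $\vec\theta\in\mathbb R^L$; the parameters $\alpha$, $\rho_j$ $(j>0)$, $\gamma_k$ $(k>0)$, $\vec\theta$ are otherwise unrestricted. $\mathscr H\subset\mathbb R^I$ is the linear space of all vectors $\vec\eta$ of this form. $Z^\circ$ is the $JK\times L$ matrix with rows $z_{jk}^T$, $j,k>0$; it is assumed to have rank $L$. $C$ is the $I\times JK$ matrix with columns $c_{jk}=\vec e_{jk}+\vec e_{00}-\vec e_{j0}-\vec e_{0k}$, $j,k>0$ (ordered as the rows of $Z^\circ$). Sampling schemes. (M): $\vec R$ is multinomial with fixed total $n$; (P): the $R_{jk}$ are independent Poisson; (MR): the rows of $R$ are independent multinomial with fixed row totals; (MC): the columns of $R$ are independent multinomial with fixed column totals. The associated space is $\mathscr N=\mathscr D$ for (M), $\mathscr N=\{0\}$ for (P), $\mathscr N=\mathscr R$ for (MR), $\mathscr N=\mathscr C$ for (MC). Estimators and asymptotic covariance matrices. $\hat\mu$ is the maximum likelihood estimator of $\mu$ under $\vec\eta\in\mathscr H$, $\hat\eta=\log\hat\mu$, and $\vec{\hat\theta}$ is the parameter value in the model representation of $\hat\eta$ (the parameter $\vec\theta$ is a linear function of $\vec\eta\in\mathscr H$). By a theorem of Haberman (fixed cells, suitably increasing expectations), $\vec{\hat\eta}$ is asymptotically normal with asymptotic covariance matrix $\Sigma_{\hat\eta}=[P^D_{\mathscr H}-P^D_{\mathscr N}]D^{-1}$; this is taken as given. The asymptotic covariance matrix of an estimator that is a linear function $A\vec{\hat\eta}$ of $\vec{\hat\eta}$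 is $A\Sigma_{\hat\eta}A^T$. *)

(* Defs.v *)
(* MathComp / MathComp-Analysis; the reals are an arbitrary R : realType. *)
From HB Require Import structures.
From mathcomp Require Import all_boot all_order all_algebra.
From mathcomp Require Import all_classical all_reals all_analysis.

Set Implicit Arguments.
Unset Strict Implicit.
Unset Printing Implicit Defensive.

Import Order.TTheory GRing.Theory Num.Theory.
Import numFieldNormedType.Exports.

Local Open Scope classical_set_scope.
Local Open Scope ring_scope.

(* mxvec stacks rows, so the table is transposed first in order to stack
   columns: a (p+1) x (q+1) table becomes a vector of length (q+1)(p+1). *)
Definition vec (R : realType) (p q : nat) (a : 'M[R]_(p, q)) : 'cV[R]_(q * p) :=
  (mxvec a^T)^T.

(* Position of the entry (j, k) in the vectorized table. *)
Definition cell (p q : nat) (j : 'I_p) (k : 'I_q) : 'I_(q * p) :=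
  mxvec_index k j.

Lemma vecE (R : realType) (p q : nat) (a : 'M[R]_(p, q)) j k :
  vec a (cell j k) 0 = a j k.
Proof. by rewrite /vec /cell mxE mxvecE mxE. Qed.

(* The indices 1, ..., n inside 0, ..., n. *)
Definition pos (n : nat) (j : 'I_n) : 'I_n.+1 := lift ord0 j.

Section LinearAlgebra.
Variables (R : realType) (J K : nat).
Local Notation table := 'M[R]_(J.+1, K.+1).
Local Notation vector := 'cV[R]_(K.+1 * J.+1).

Definition evec (j : 'I_J.+1) (k : 'I_K.+1) : vector := vec (delta_mx j k).

Definition Dspace : {vspace vector} := <[(\sum_j \sum_k evec j k)%R]>%VS.
Definition Rspace : {vspace vector} :=
  <<[seq (\sum_k evec j k)%R | j <- enum 'I_J.+1]>>%VS.
Definition Cspace : {vspace vector} :=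
  <<[seq (\sum_j evec j k)%R | k <- enum 'I_K.+1]>>%VS.

Definition contrast_col (j : 'I_J) (k : 'I_K) : vector :=
  evec (pos j) (pos k) + evec 0 0 - evec (pos j) 0 - evec 0 (pos k).

(* Each row of C is a J x K table in vectorized form. *)
Definition contrast_mx : 'M[R]_(K.+1 * J.+1, K * J) :=
  \matrix_(i, c) vec (\matrix_(j, k) contrast_col j k i 0) c 0.

Lemma col_contrast_mx j k : col (cell j k) contrast_mx = contrast_col j k.
Proof. by apply/colP => i; rewrite mxE mxE vecE mxE. Qed.

(* Each column of Z° is a J x K table in vectorized form. *)
Definition Zcirc (L : nat) (z : 'I_J.+1 -> 'I_K.+1 -> 'cV[R]_L) :
    'M[R]_(K * J, L) :=
  \matrix_(c, l) vec (\matrix_(j, k) z (pos j) (pos k) l 0) c 0.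

Lemma row_Zcirc (L : nat) (z : 'I_J.+1 -> 'I_K.+1 -> 'cV[R]_L) j k :
  row (cell j k) (Zcirc z) = (z (pos j) (pos k))^T.
Proof. by apply/rowP => l; rewrite mxE mxE vecE mxE [RHS]mxE. Qed.

Definition mean_diag (mu : table) : 'M[R]_(K.+1 * J.+1) := diag_mx (vec mu)^T.

End LinearAlgebra.

Section Projection.
Variables (R : realType) (n : nat).

Definition dot_wrt (D : 'M[R]_n) (a b : 'cV[R]_n) : R := (a^T *m D *m b) 0 0.

Definition is_orthproj (D : 'M[R]_n) (M : set 'cV[R]_n) (P : 'M[R]_n) : Prop :=
  forall x : 'cV[R]_n,
    M (P *m x) /\ forall y, M y -> dot_wrt D y (x - P *m x) = 0.

(* For D symmetric positive definite and M a subspace there is exactly one such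
   matrix; the default value 0 is irrelevant. *)
Definition orthproj (D : 'M[R]_n) (M : set 'cV[R]_n) : 'M[R]_n :=
  xget 0 [set P | is_orthproj D M P].

End Projection.

Section Model.
Variables (R : realType) (J K L : nat) (z : 'I_J.+1 -> 'I_K.+1 -> 'cV[R]_L).
Local Notation table := 'M[R]_(J.+1, K.+1).
Local Notation vector := 'cV[R]_(K.+1 * J.+1).

Definition has_params (eta : table) (alpha : R) (rho : 'I_J.+1 -> R)
    (gamma : 'I_K.+1 -> R) (theta : 'cV[R]_L) : Prop :=
  [/\ rho 0 = 0, gamma 0 = 0 &
    forall j k, eta j k = alpha + rho j + gamma k + ((z j k)^T *m theta) 0 0].

Definition has_theta (eta : table) (theta : 'cV[R]_L) : Prop :=
  exists alpha rho gamma, has_params eta alpha rho gamma theta.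

Definition Hspace : set vector :=
  [set v | exists eta theta, v = vec eta /\ has_theta eta theta].

(* A is a matrix of the linear function eta |-> theta on H; it is not
   determined outside H. *)
Definition is_theta_map (A : 'M[R]_(L, K.+1 * J.+1)) : Prop :=
  forall eta theta, has_theta eta theta -> A *m vec eta = theta.

End Model.

Inductive scheme := Multinomial | Poisson | MultinomialRows | MultinomialCols.

Definition Nspace (R : realType) (J K : nat) (s : scheme) :
    {vspace 'cV[R]_(K.+1 * J.+1)} :=
  match s with
  | Multinomial => Dspace R J K
  | Poisson => 0%VS
  | MultinomialRows => Rspace R J K
  | MultinomialCols => Cspace R J K
  end.

Section Sampling.
Variables (R : realType) (J K : nat).
Local Notation table := 'M[R]_(J.+1, K.+1).
Local Notation counts := 'M[nat]_(J.+1, K.+1).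

(* Multinomial probability of x, with total \sum_i x i and cell probabilities
   q i / \sum_i q i. *)
Definition multinomial_pmf (I : finType) (q : I -> R) (x : I -> nat) : R :=
  ((\sum_i x i)%N)`!%:R / (\prod_i (x i)`!%:R)
    * \prod_i (q i / \sum_i' q i') ^+ x i.

(* Under each scheme the totals fixed by design agree for the counts and for
   their expectations. *)
Definition fixed_totals (s : scheme) (mu : table) (r : counts) : Prop :=
  match s with
  | Multinomial => \sum_j \sum_k mu j k = \sum_j \sum_k (r j k)%:R
  | Poisson => True
  | MultinomialRows => forall j, \sum_k mu j k = \sum_k (r j k)%:R
  | MultinomialCols => forall k, \sum_j mu j k = \sum_j (r j k)%:R
  end.

(* The probability of the counts r when their expectations are mu. *)
Definition table_pmf (s : scheme) (mu : table) (r : counts) : R :=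
  if `[< fixed_totals s mu r >] then
    match s with
    | Multinomial =>
        multinomial_pmf (fun c : 'I_J.+1 * 'I_K.+1 => mu c.1 c.2)
                        (fun c => r c.1 c.2)
    | Poisson => \prod_j \prod_k poisson_pmf (mu j k) (r j k)
    | MultinomialRows => \prod_j multinomial_pmf (mu j) (r j)
    | MultinomialCols =>
        \prod_k multinomial_pmf (fun j => mu j k) (fun j => r j k)
    end
  else 0.

Definition random_table (s : scheme) (mu : table) (d : measure_display)
    (T : measurableType d) (P : probability T R) (X : T -> counts) : Prop :=
  [/\ forall r, measurable (X @^-1` [set r]),
      forall r, P (X @^-1` [set r]) = (table_pmf s mu r)%:E &
      forall j k, 'E_P[fun w => (X w j k)%:R] = (mu j k)%:E]%E.

Definition log_table (mu : table) : table := map_mx (@ln R) mu.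

Section Estimators.
Variables (L : nat) (z : 'I_J.+1 -> 'I_K.+1 -> 'cV[R]_L).

Definition admissible (s : scheme) (r : counts) (mu : table) : Prop :=
  [/\ forall j k, 0 < mu j k, Hspace z (vec (log_table mu)) &
      fixed_totals s mu r].

(* muhat is a maximum likelihood estimate from the observed counts r; there may
   be none, e.g. when some counts are zero. *)
Definition is_mle (s : scheme) (r : counts) (muhat : table) : Prop :=
  admissible s r muhat /\
  forall mu, admissible s r mu -> table_pmf s mu r <= table_pmf s muhat r.

(* Haberman's asymptotic covariance matrix of the estimator of vec eta. *)
Definition Sigma_eta (s : scheme) (mu : table) : 'M[R]_(K.+1 * J.+1) :=
  let D := mean_diag mu in
  (orthproj D (Hspace z) - orthproj D [set v | v \in Nspace R J K s])
    *m invmx D.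

(* Asymptotic covariance matrix of the estimator A *m vec etahat. *)
Definition asymp_cov_linear (s : scheme) (mu : table) (m : nat)
    (A : 'M[R]_(m, K.+1 * J.+1)) : 'M[R]_m :=
  A *m Sigma_eta s mu *m A^T.

End Estimators.
End Sampling.

(* Main.v *)
(* A table eta belongs to H with parameter theta exactly when C^T eta = Zo theta:
   the contrasts C kill the main effects.  Hence, with G = C^T D^-1 C and
   W = Zo^T G^-1 Zo, the D-orthogonal projection P onto H has the closed form
   1 - D^-1 C (G^-1 - G^-1 Zo W^-1 Zo^T G^-1) C^T, and A P = W^-1 Zo^T G^-1 C^T for
   any matrix A of the map eta |-> theta.  Since N lies in the kernel of C^T, A
   kills the projection onto N; as P D^-1 = P D^-1 P^T, the covariance matrix is
   (A P) D^-1 (A P)^T = W^-1. *)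
Require Import Defs.
From HB Require Import structures.
From mathcomp Require Import all_boot all_order all_algebra.
From mathcomp Require Import all_classical all_reals all_analysis.
From mathcomp Require Import ring.

Import Order.TTheory GRing.Theory Num.Theory.
Import numFieldNormedType.Exports.

Local Open Scope classical_set_scope.
Local Open Scope ring_scope.

Set Implicit Arguments.
Unset Strict Implicit.
Unset Printing Implicit Defensive.

(** * Anisotropic forms and uniqueness of orthogonal projections *)

Section Anisotropic.
Variable R : realType.

(** An inequality-free substitute for definiteness: it yields invertibility and unique projections,
    and survives injective congruence. *)
Definition anisotropic n (S : 'M[R]_n) : Prop :=
  forall x : 'cV[R]_n, x^T *m S *m x = 0 -> x = 0.

Lemma anisotropic_unitmx n (S : 'M[R]_n) : anisotropic S -> S \in unitmx.
Proof.
move=> aS; rewrite -unitmx_tr unitmxE unitfE; apply/det0P => -[v v0 vS].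
case/eqP: v0; apply: trmx_inj; rewrite trmx0; apply: aS.
by rewrite trmxK -mulmxA -[S]trmxK -trmx_mul vS trmx0 mulmx0.
Qed.

Lemma anisotropic_congr m n (S : 'M[R]_n) (B : 'M[R]_(n, m)) :
  anisotropic S -> (forall x : 'cV[R]_m, B *m x = 0 -> x = 0) ->
  anisotropic (B^T *m S *m B).
Proof. by move=> aS injB x h; apply/injB/aS; rewrite trmx_mul !mulmxA in h *. Qed.

(** By symmetry [S^-1 = (S^-1)^T S S^-1], a congruence of [S] by an injective matrix. *)
Lemma anisotropic_invmx n (S : 'M[R]_n) :
  S^T = S -> anisotropic S -> anisotropic (invmx S).
Proof.
move=> symS aS; have uS := anisotropic_unitmx aS.
have := @anisotropic_congr n n S (invmx S) aS.
rewrite trmx_inv symS mulVmx // mul1mx; apply => x Sx0.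
by rewrite -[x](mulKVmx uS) Sx0 mulmx0.
Qed.

Lemma anisotropic_diag n (d : 'rV[R]_n) :
  (forall i, 0 < d 0 i) -> anisotropic (diag_mx d).
Proof.
move=> d0 x /(congr1 (fun M : 'M[R]_1 => M 0 0)); rewrite !mxE => /eqP.
under eq_bigr => i _ do rewrite mul_mx_diag !mxE mulrAC -expr2.
rewrite psumr_eq0 => [|i _]; last by rewrite mulr_ge0 ?sqr_ge0 ?ltW.
move=> /allP x0; apply/colP => i; rewrite mxE; apply/eqP.
have := x0 i (mem_index_enum i).
by rewrite mulf_eq0 (gt_eqF (d0 i)) orbF sqrf_eq0.
Qed.

Lemma anisotropic_self n (x : 'cV[R]_n) : x^T *m x = 0 -> x = 0.
Proof.
have := @anisotropic_diag n (const_mx 1) _ x.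
by rewrite diag_const_mx mulmx1; apply=> i; rewrite mxE.
Qed.

Lemma eq_mulmx_cV m n (P Q : 'M[R]_(m, n)) :
  (forall x : 'cV[R]_n, P *m x = Q *m x) -> P = Q.
Proof. by move=> PQ; apply/trmx_inj/row_matrixP => i; rewrite -!tr_col !colE PQ. Qed.

Lemma orthproj_unique n (D : 'M[R]_n) (M : set 'cV[R]_n) (P Q : 'M[R]_n) :
  anisotropic D -> (forall x y, M x -> M y -> M (x - y)) ->
  is_orthproj D M P -> is_orthproj D M Q -> P = Q.
Proof.
move=> aD MB hP hQ.
apply: eq_mulmx_cV => x.
apply/eqP; rewrite -subr_eq0; apply/eqP/aD.
have [[MP oP] [MQ oQ]] := (hP x, hQ x).
have Md := MB _ _ MP MQ.
(* Only the right factor is rewritten: the left one stays a member of [M], to which both residuals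
   are [D]-orthogonal. *)
have {2}-> : P *m x - Q *m x = (x - Q *m x) - (x - P *m x).
  by rewrite opprB [RHS]addrC addrA subrK.
rewrite mulmxBr; apply/matrixP => i j; rewrite !ord1 mxE [X in _ + X]mxE.
by have := (oQ _ Md, oP _ Md); rewrite /dot_wrt => -[-> ->]; rewrite subrr mxE.
Qed.

Lemma orthproj_eq n (D : 'M[R]_n) (M : set 'cV[R]_n) (P : 'M[R]_n) :
  anisotropic D -> (forall x y, M x -> M y -> M (x - y)) ->
  is_orthproj D M P -> orthproj D M = P.
Proof.
by move=> aD MB hP; apply: xget_unique => // Q hQ; apply: orthproj_unique hQ hP.
Qed.

(* The default value 0 of [orthproj] also maps into any subspace, so the
   existence of the projection plays no role. *)
Lemma orthproj_mem n (D : 'M[R]_n) (M : set 'cV[R]_n) (x : 'cV[R]_n) :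
  M 0 -> M (orthproj D M *m x).
Proof.
move=> M0; rewrite /orthproj; case: xgetP => [P _ hP|_]; last by rewrite mul0mx.
by case: (hP x).
Qed.

End Anisotropic.

(** * Table positions as vector indices *)

Section Table.
Variables (R : realType) (p q : nat).

Lemma cell_ind (Q : 'I_(q * p) -> Prop) : (forall j k, Q (cell j k)) -> forall i, Q i.
Proof. by move=> hQ i; case/mxvec_indexP: i => k j; apply: hQ. Qed.

Lemma vec_surj (v : 'cV[R]_(q * p)) : exists a : 'M[R]_(p, q), v = vec a.
Proof. by exists (vec_mx v^T)^T; rewrite /vec trmxK vec_mxK trmxK. Qed.

End Table.

(** * The contrast matrix and its kernel *)

Section Contrast.
Variables (R : realType) (J K : nat).
Local Notation C := (contrast_mx R J K).

Lemma tr_evec_mul (j : 'I_J.+1) (k : 'I_K.+1) (v : 'cV[R]_(K.+1 * J.+1)) :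
  (evec R j k)^T *m v = (v (cell j k) 0)%:M.
Proof.
rewrite /evec /vec trmxK trmx_delta mxvec_delta -rowE.
by rewrite [LHS]mx11_scalar mxE.
Qed.

Lemma contrastE (v : 'cV[R]_(K.+1 * J.+1)) j k :
  (C^T *m v) (cell j k) 0 =
  v (cell (pos j) (pos k)) 0 + v (cell 0 0) 0
  - v (cell (pos j) 0) 0 - v (cell 0 (pos k)) 0.
Proof.
transitivity (row (cell j k) (C^T *m v) 0 0); first by rewrite [RHS]mxE.
rewrite row_mul -tr_col col_contrast_mx /contrast_col !linearB linearD /=.
by rewrite !mulmxBl mulmxDl !tr_evec_mul !mxE.
Qed.

(** Any [u] equals [C^T v] for a suitable [v], hence [u^T u = (C u)^T v = 0]. *)
Lemma contrast_mx_inj (u : 'cV[R]_(K * J)) : C *m u = 0 -> u = 0.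
Proof.
move=> Cu0; apply: anisotropic_self.
(* [v] is [u] bordered by zeros in row 0 and column 0, so each contrast keeps a single term. *)
pose v : 'cV[R]_(K.+1 * J.+1) := vec (\matrix_(j, k)
  oapp (fun j' => oapp (fun k' => u (cell j' k') 0) 0 (unlift 0 k)) 0 (unlift 0 j)).
have {2}-> : u = C^T *m v.
  apply/colP; elim/cell_ind => j k; rewrite contrastE !vecE !mxE.
  by rewrite !liftK !unlift_none /= addr0 !subr0.
by rewrite mulmxA -trmx_mul Cu0 trmx0 mul0mx.
Qed.

(** Row and column indicator tables depend on one index only, so their contrasts cancel; each
    nonzero choice of [N] is spanned by such tables or by their sum. *)
Lemma Nspace_contrast (s : scheme) v : v \in Nspace R J K s -> C^T *m v = 0.
Proof.
have sumR j : C^T *m (\sum_k evec R j k) = 0.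
  apply/colP; elim/cell_ind => i l; rewrite contrastE !summxE !mxE.
  have E a b : \sum_k evec R j k (cell a b) 0 = (a == j)%:R.
    under eq_bigr => k _ do rewrite /evec vecE mxE.
    rewrite (bigD1 b) //= eqxx andbT big1 ?addr0 // => k kb.
    by rewrite [b == k]eq_sym (negbTE kb) andbF.
  by rewrite !E; ring.
have sumC k : C^T *m (\sum_j evec R j k) = 0.
  apply/colP; elim/cell_ind => i l; rewrite contrastE !summxE !mxE.
  have E a b : \sum_j evec R j k (cell a b) 0 = (b == k)%:R.
    under eq_bigr => j _ do rewrite /evec vecE mxE.
    rewrite (bigD1 a) //= eqxx big1 ?addr0 // => j ja.
    by rewrite [a == j]eq_sym (negbTE ja).
  by rewrite !E; ring.
have span_ker (X : seq 'cV[R]_(K.+1 * J.+1)) :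
    (forall x, x \in X -> C^T *m x = 0) -> v \in <<X>>%VS -> C^T *m v = 0.
  move=> X0; suff /subvP XS : (<<X>> <= lker (linfun (mulmx C^T)))%VS.
    by move=> /XS; rewrite memv_ker lfunE => /eqP.
  by apply/span_subvP => x /X0 x0; rewrite memv_ker lfunE /= x0.
case: s => /=.
- by case/vlineP => c ->; rewrite -scalemxAr mulmx_sumr big1 ?scaler0.
- by rewrite memv0 => /eqP ->; rewrite mulmx0.
- by apply: span_ker => x /mapP[j _ ->].
- by apply: span_ker => x /mapP[j _ ->].
Qed.

End Contrast.

(** * The model space described through contrasts *)

Section LogLinear.
Variables (R : realType) (J K L : nat) (z : 'I_J.+1 -> 'I_K.+1 -> 'cV[R]_L).
Hypotheses (hz0 : forall j, z j 0 = 0) (h0z : forall k, z 0 k = 0).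
Local Notation C := (contrast_mx R J K).
Local Notation Zo := (Zcirc z).

Lemma Zcirc_mulE (t : 'cV[R]_L) j k :
  (Zo *m t) (cell j k) 0 = ((z (pos j) (pos k))^T *m t) 0 0.
Proof. by rewrite -row_Zcirc -row_mul [RHS]mxE. Qed.

(** Main effects cancel in the contrasts and [z] vanishes in row 0 and column 0. This trades the
    existential parameters for one linear equation. *)
Lemma has_thetaP (eta : 'M[R]_(J.+1, K.+1)) (t : 'cV[R]_L) :
  has_theta z eta t <-> C^T *m vec eta = Zo *m t.
Proof.
have zt0 : ((0 : 'cV[R]_L)^T *m t) 0 0 = 0 by rewrite trmx0 mul0mx mxE.
split=> [[alpha [rho [gamma [rho0 gamma0 etaE]]]]|CZ].
  apply/colP; elim/cell_ind => j k; rewrite contrastE !vecE Zcirc_mulE !etaE.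
  by rewrite !hz0 !h0z !zt0 rho0 gamma0; ring.
(* Row 0 and column 0, where [z] vanishes, force these values. *)
exists (eta 0 0), (fun j => eta j 0 - eta 0 0), (fun k => eta 0 k - eta 0 0).
split; rewrite ?subrr // => j k.
case: (unliftP 0 j) => [j'|] ->; last first.
  by rewrite h0z zt0; ring.
case: (unliftP 0 k) => [k'|] ->; last first.
  by rewrite hz0 zt0; ring.
by rewrite -[lift ord0 j']/(pos j') -[lift ord0 k']/(pos k') -Zcirc_mulE -CZ
  contrastE !vecE; ring.
Qed.

Lemma HspaceP (v : 'cV[R]_(K.+1 * J.+1)) :
  Hspace z v <-> exists t, C^T *m v = Zo *m t.
Proof.
split=> [[eta [t [-> /has_thetaP]]]|[t]]; first by exists t.
by have [eta ->] := vec_surj v => /has_thetaP; exists eta, t.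
Qed.

Lemma theta_map_eq A (v : 'cV[R]_(K.+1 * J.+1)) t :
  is_theta_map z A -> C^T *m v = Zo *m t -> A *m v = t.
Proof. by move=> hA; have [eta ->] := vec_surj v => /has_thetaP /hA. Qed.

Lemma Hspace_sub u v : Hspace z u -> Hspace z v -> Hspace z (u - v).
Proof.
move=> /HspaceP[s us] /HspaceP[t vt]; apply/HspaceP.
by exists (s - t); rewrite !mulmxBr us vt.
Qed.

Hypothesis hZ : \rank Zo = L.

Lemma Zcirc_linv : exists B, B *m Zo = 1%:M.
Proof. by apply/row_fullP; rewrite /row_full hZ. Qed.

Lemma Zcirc_inj (t : 'cV[R]_L) : Zo *m t = 0 -> t = 0.
Proof.
by case: Zcirc_linv => B BZ Zt; rewrite -[t]mul1mx -BZ -mulmxA Zt mulmx0.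
Qed.

Lemma theta_map_exists : exists A, is_theta_map z A.
Proof.
case: Zcirc_linv => B BZ; exists (B *m C^T) => eta t /has_thetaP CZ.
by rewrite -mulmxA CZ mulmxA BZ mul1mx.
Qed.

(** * The Gram matrix [G] and the information matrix [W] *)

Variable mu : 'M[R]_(J.+1, K.+1).
Hypothesis hmu : forall j k, 0 < mu j k.
Local Notation D := (mean_diag mu).
Local Notation G := (C^T *m invmx D *m C).
Local Notation W := (Zo^T *m invmx G *m Zo).

Lemma tr_mean_diag : D^T = D. Proof. exact: tr_diag_mx. Qed.

Lemma mean_diag_anisotropic : anisotropic D.
Proof.
by apply: anisotropic_diag; elim/cell_ind => j k; rewrite mxE vecE.
Qed.

Lemma mean_diag_unitmx : D \in unitmx.
Proof. exact/anisotropic_unitmx/mean_diag_anisotropic. Qed.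

Lemma invmx_mean_diagE m (B : 'M[R]_(_, m)) j k i :
  (invmx D *m B) (cell j k) i = (mu j k)^-1 * B (cell j k) i.
Proof.
rewrite -[in RHS](mulKVmx mean_diag_unitmx B) mul_diag_mx [X in _ * X]mxE.
by rewrite [(vec _)^T _ _]mxE vecE mulKf // gt_eqF.
Qed.

Lemma tr_invmx_mean_diag : (invmx D)^T = invmx D.
Proof. by rewrite trmx_inv tr_mean_diag. Qed.

Lemma tr_contrast_gram : G^T = G.
Proof. by rewrite !trmx_mul trmxK tr_invmx_mean_diag mulmxA. Qed.

Lemma contrast_gram_anisotropic : anisotropic G.
Proof.
apply: anisotropic_congr; last exact: contrast_mx_inj.
by apply: anisotropic_invmx; [exact: tr_mean_diag | exact: mean_diag_anisotropic].
Qed.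

Lemma contrast_gram_unitmx : G \in unitmx.
Proof. exact/anisotropic_unitmx/contrast_gram_anisotropic. Qed.

Lemma tr_invmx_gram : (invmx G)^T = invmx G.
Proof. by rewrite trmx_inv tr_contrast_gram. Qed.

Lemma information_unitmx : W \in unitmx.
Proof.
apply/anisotropic_unitmx/anisotropic_congr; last exact: Zcirc_inj.
by apply: anisotropic_invmx; [exact: tr_contrast_gram | exact: contrast_gram_anisotropic].
Qed.

Lemma tr_information : W^T = W.
Proof. by rewrite !trmx_mul trmxK tr_invmx_gram mulmxA. Qed.

(** One formula with indicators covers all index patterns; the minus signs of the two contrasts
    meet, so every term enters with a plus sign. *)
Lemma contrast_gramE j k l m : G (cell j k) (cell l m) =
  (mu (pos j) (pos k))^-1 * ((j == l) && (k == m))%:R + (mu 0 0)^-1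
  + (mu (pos j) 0)^-1 * (j == l)%:R + (mu 0 (pos k))^-1 * (k == m)%:R.
Proof.
transitivity ((C^T *m (invmx D *m contrast_col R l m)) (cell j k) 0).
  by rewrite -col_contrast_mx [in RHS]colE !mulmxA -colE [RHS]mxE.
have E a b : contrast_col R l m (cell a b) 0 =
    ((a == pos l) && (b == pos m))%:R + ((a == 0) && (b == 0))%:R
    - ((a == pos l) && (b == 0))%:R - ((a == 0) && (b == pos m))%:R :> R.
  have addE (u v : 'cV[R]_(K.+1 * J.+1)) i : (u + v) i 0 = u i 0 + v i 0.
    by rewrite mxE.
  have oppE (u : 'cV[R]_(K.+1 * J.+1)) i : (- u) i 0 = - u i 0.
    by rewrite mxE.
  by rewrite /contrast_col !(addE, oppE) /evec !vecE !mxE.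
have pos0 n (i : 'I_n) : (pos i == 0) = false by [].
have zpos n (i : 'I_n) : (0 == pos i) = false by [].
have posE n : injective (@pos n) := lift_inj.
rewrite contrastE !invmx_mean_diagE !E !pos0 !zpos !(inj_eq (@posE _)) !eqxx.
by rewrite !andbF !andbT /=; ring.
Qed.

(** * Closed form of the projection onto [H] *)

Lemma invmx_informationK : invmx W *m (Zo^T *m (invmx G *m Zo)) = 1%:M.
Proof. by rewrite (mulmxA Zo^T (invmx G)) (mulVmx information_unitmx). Qed.

(** Equals [G^-1 (1 - Q)], where [Q = Zo W^-1 Zo^T G^-1] is the [G^-1]-orthogonal projection onto
    the columns of [Zo]: the residual of generalized least squares on the contrasts. *)
Definition Hresidual : 'M[R]_(K * J) :=
  invmx G - invmx G *m Zo *m invmx W *m Zo^T *m invmx G.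

Lemma tr_Hresidual : Hresidual^T = Hresidual.
Proof.
rewrite linearB /= !trmx_mul !tr_invmx_gram trmx_inv tr_information trmxK.
by rewrite !mulmxA.
Qed.

Lemma Hresidual_Zcirc : Hresidual *m Zo = 0.
Proof.
(* The inverses are made opaque so that reassociation leaves the products inside them intact. *)
rewrite /Hresidual; move: (invmx W) invmx_informationK => iW; move: (invmx G) => iG WK.
by rewrite mulmxBl -!mulmxA WK mulmx1 subrr.
Qed.

(* D^-1 C Hresidual C^T x is the component of x that is D-orthogonal to H. *)
Definition Hproj : 'M[R]_(K.+1 * J.+1) :=
  1%:M - invmx D *m C *m Hresidual *m C^T.

(** As [C^T D^-1 C = G], the subtracted term is [(1 - Q) C^T] and [Q C^T] remains. The factor after
    [Zo] gives the parameter of the projected vector. *)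
Lemma contrast_Hproj :
  C^T *m Hproj = Zo *m (invmx W *m Zo^T *m invmx G *m C^T).
Proof.
rewrite mulmxBr mulmx1 [C^T *m (_ *m _)]mulmxA [C^T *m (_ *m _)]mulmxA.
rewrite [C^T *m (_ *m _)]mulmxA /Hresidual [G *m (_ - _)]mulmxBr.
rewrite (mulmxV contrast_gram_unitmx) !mulmxA (mulmxV contrast_gram_unitmx).
by rewrite !mul1mx mulmxBl mul1mx opprB addrC subrK.
Qed.

(** The contrasts of [Hproj] lie in the column space of [Zo], which [Hresidual] kills. *)
Lemma Hproj_idem : Hproj *m Hproj = Hproj.
Proof.
rewrite {1}/Hproj mulmxBl mul1mx -[_ *m C^T *m _]mulmxA contrast_Hproj.
rewrite -[_ *m Hresidual *m _]mulmxA [Hresidual *m _]mulmxA Hresidual_Zcirc.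
by rewrite mul0mx mulmx0 subr0.
Qed.

Lemma Hproj_selfadjoint : Hproj *m invmx D = invmx D *m Hproj^T.
Proof.
rewrite linearB /= trmx1 !trmx_mul trmxK tr_Hresidual tr_invmx_mean_diag.
by rewrite /Hproj mulmxBl [invmx D *m (1%:M - _)]mulmxBr mul1mx mulmx1 !mulmxA.
Qed.

Lemma Hproj_orthproj : is_orthproj D (Hspace z) Hproj.
Proof.
move=> x; split.
  by apply/HspaceP; eexists; rewrite mulmxA contrast_Hproj -mulmxA.
move=> y /HspaceP[t Cy].
(* [D] will cancel [D^-1] in the inner product, leaving the factor
   [y^T C Hresidual = (Hresidual Zo t)^T = 0]. *)
have -> : x - Hproj *m x = invmx D *m (C *m Hresidual *m C^T *m x).
  by rewrite mulmxBl mul1mx opprB addrC subrK !mulmxA.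
rewrite /dot_wrt -[y^T *m D *m _]mulmxA (mulKVmx mean_diag_unitmx) !mulmxA.
have -> : y^T *m C *m Hresidual = 0.
  apply: trmx_inj; rewrite trmx_mul tr_Hresidual trmx_mul trmxK Cy mulmxA.
  by rewrite Hresidual_Zcirc mul0mx trmx0.
by rewrite !mul0mx mxE.
Qed.

Lemma orthproj_Hspace : orthproj D (Hspace z) = Hproj.
Proof.
apply: orthproj_eq; [exact: mean_diag_anisotropic | exact: Hspace_sub |].
exact: Hproj_orthproj.
Qed.

(** * The covariance matrix of the estimator *)

Variable A : 'M[R]_(L, K.+1 * J.+1).
Hypothesis hA : is_theta_map z A.

Lemma theta_map_Hproj : A *m Hproj = invmx W *m Zo^T *m invmx G *m C^T.
Proof.
apply: eq_mulmx_cV => x; rewrite -mulmxA.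
by apply: (theta_map_eq hA); rewrite mulmxA contrast_Hproj mulmxA.
Qed.

Lemma asymp_cov_theta (s : scheme) : asymp_cov_linear z s mu A = invmx W.
Proof.
rewrite /asymp_cov_linear /Sigma_eta orthproj_Hspace.
set PN := orthproj _ _.
(* A vector of [N] has zero contrasts, so it lies in [H] with parameter 0. *)
have APN : A *m PN = 0.
  apply: eq_mulmx_cV => x; rewrite mul0mx -mulmxA.
  apply: (theta_map_eq hA); rewrite mulmx0.
  apply: (@Nspace_contrast _ _ _ s).
  exact: (@orthproj_mem _ _ D [set v | v \in Nspace R J K s] x (mem0v _)).
(* Idempotence doubles [Hproj], so that one copy can cross [D^-1] as a transpose. *)
rewrite mulmxA mulmxBr APN subr0 -Hproj_idem mulmxA.
rewrite -[A *m _ *m _ *m _]mulmxA Hproj_selfadjoint mulmxA.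
rewrite -[_ *m Hproj^T *m _]mulmxA -trmx_mul theta_map_Hproj.
rewrite !trmx_mul !trmxK tr_invmx_gram trmx_inv tr_information.
(* The middle of the product collapses to [G G^-1]; one [W^-1] then cancels against
   [Zo^T G^-1 Zo]. *)
have CGC : C^T *m (invmx D *m (C *m invmx G)) = 1%:M.
  by rewrite !mulmxA (mulmxV contrast_gram_unitmx).
move: (invmx W) invmx_informationK => iW; move: (invmx G) CGC => iG CGC WK.
rewrite -!mulmxA (mulmxA C iG) (mulmxA (invmx D)) (mulmxA C^T) CGC mul1mx.
by rewrite (mulmxA iG) (mulmxA Zo^T) mulmxA WK mul1mx.
Qed.

End LogLinear.

Unset Implicit Arguments.
Set Strict Implicit.
Set Printing Implicit Defensive.

(** [A] ranges over all matrices of the parameter map, which agree only on [H]. Existence keeps this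
    from being vacuous, and the unit claims make each [invmx] a genuine inverse. *)
Theorem theorem2 (R : realType) (J K L : nat) (hJ : (1 <= J)%N) (hK : (1 <= K)%N)
    (z : 'I_J.+1 -> 'I_K.+1 -> 'cV[R]_L)
    (hz0 : forall j, z j 0 = 0) (h0z : forall k, z 0 k = 0)
    (hZ : \rank (Zcirc z) = L)
    (s : scheme) (mu : 'M[R]_(J.+1, K.+1)) (hmu : forall j k, 0 < mu j k)
    (d : measure_display) (T : measurableType d) (P : probability T R)
    (X : T -> 'M[nat]_(J.+1, K.+1)) (hX : random_table s mu P X)
    (alpha : R) (rho : 'I_J.+1 -> R) (gamma : 'I_K.+1 -> R) (theta : 'cV[R]_L)
    (hmodel : has_params z (log_table mu) alpha rho gamma theta) :
  let Zo := Zcirc z in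
  let C := contrast_mx R J K in
  let D := mean_diag mu in
  let G := C^T *m invmx D *m C in
  [/\ exists A : 'M[R]_(L, K.+1 * J.+1), is_theta_map z A,
      forall A : 'M[R]_(L, K.+1 * J.+1), is_theta_map z A ->
        (forall (w : T) (muhat : 'M[R]_(J.+1, K.+1)) (thetahat : 'cV[R]_L),
           is_mle z s (X w) muhat -> has_theta z (log_table muhat) thetahat ->
           thetahat = A *m vec (log_table muhat)) /\
        asymp_cov_linear z s mu A = invmx (Zo^T *m invmx G *m Zo),
      [/\ D \in unitmx, G \in unitmx & Zo^T *m invmx G *m Zo \in unitmx] &
      [/\ forall (j : 'I_J) (k : 'I_K),
            G (cell j k) (cell j k) =
              (mu (pos j) (pos k))^-1 + (mu 0 0)^-1 + (mu (pos j) 0)^-1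
                + (mu 0 (pos k))^-1,
          forall (j l : 'I_J) (k m : 'I_K), j != l -> k != m ->
            G (cell j k) (cell l m) = (mu 0 0)^-1,
          forall (j : 'I_J) (k m : 'I_K), k != m ->
            G (cell j k) (cell j m) = (mu 0 0)^-1 + (mu (pos j) 0)^-1 &
          forall (j l : 'I_J) (k : 'I_K), j != l ->
            G (cell j k) (cell l k) = (mu 0 0)^-1 + (mu 0 (pos k))^-1]].
Proof.
move=> Zo C D G; split.
- exact: theta_map_exists.
- move=> A hA; split; last exact: asymp_cov_theta.
  by move=> w muhat thetahat _ /hA ->.
- split; [exact: mean_diag_unitmx | exact: contrast_gram_unitmx |].
  exact: information_unitmx.
- split=> [j k|j l k m jl km|j k m km|j l k jl]; rewrite contrast_gramE //.
  + by rewrite !eqxx !mulr1.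
  + by rewrite (negbTE jl) (negbTE km) !mulr0 add0r !addr0.
  + by rewrite eqxx (negbTE km) !mulr0 mulr1 add0r addr0.
  + by rewrite eqxx (negbTE jl) !mulr0 mulr1 add0r addr0.
Qed.
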